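(* Let $\mathbf{k}$ be a field of characteristic $0$ and let $(A,\mu,\alpha)$ be a multiplicative right Hom-alternative algebra over $\mathbf{k}$. Suppose that $\alpha$ is injective and that $A$ has no Hom-nilpotent elements. Then $A$ is a Hom-alternative algebra.
   Context: A Hom-algebra over $\mathbf{k}$ is a triple $(A,\mu,\alpha)$ where $A$ is a $\mathbf{k}$-module, $\mu\colon A^{\otimes 2}\to A$ is a bilinear map (written $xy=\mu(x,y)$; not assumed associative, commutative or unital), and $\alpha\colon A\to A$ is a linear map (the twisting map). It is multiplicative if $\alpha(xy)=\alpha(x)\alpha(y)$ for all $x,y\in A$. The Hom-associator is $(x,y,z)=(xy)\alpha(z)-\alpha(x)(yz)$. $A$ is right Hom-alternative if $(x,y,y)=0$ for all $x,y\in A$, left Hom-alternative if $(x,x,y)=0$ for all $x,y\in A$, and Hom-alternative if it is both left and right Hom-alternative. $\alpha^n$ is the $n$-fold composition of $\alpha$, with $\alpha^0=\mathrm{Id}$. The Hom-powers of $x\in A$ are defined by $x^1=x$ and $x^n=x^{n-1}\alpha^{n-2}(x)$ for $n\ge 2$. A Hom-nilpotent element is a non-zero element $x\in A$ such that the Hom-power $x^n$ is $0$ for some $n\ge 2$. *)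

(* Defs.v *)
From HB Require Import structures.
From mathcomp Require Import all_boot all_order all_algebra.

Set Implicit Arguments.
Unset Strict Implicit.
Unset Printing Implicit Defensive.

Import GRing.Theory.
Local Open Scope ring_scope.

Section HomAlgebra.

Variables (k : comNzRingType) (A : lmodType k).
Variables (mu : {bilinear A -> A -> A}) (alpha : {linear A -> A}).

Definition multiplicative : Prop :=
  forall x y : A, alpha (mu x y) = mu (alpha x) (alpha y).

Definition hom_associator (x y z : A) : A :=
  mu (mu x y) (alpha z) - mu (alpha x) (mu y z).

Definition right_hom_alternative : Prop :=
  forall x y : A, hom_associator x y y = 0.

Definition left_hom_alternative : Prop :=
  forall x y : A, hom_associator x x y = 0.

Definition hom_alternative : Prop :=
  left_hom_alternative /\ right_hom_alternative.

(* [hom_power x n] is x^n for n >= 1; the value x at n = 0 is junk. *)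
Fixpoint hom_power (x : A) (n : nat) : A :=
  match n with
  | 0 | 1 => x
  | (m.+1 as n').+1 => mu (hom_power x n') (iter m alpha x)
  end.

Definition hom_nilpotent (x : A) : Prop :=
  x != 0 /\ exists2 n : nat, (2 <= n)%N & hom_power x n = 0.

End HomAlgebra.

(* Main.v *)
(* On the direct limit of A -> A -> ... along alpha, the twisting map becomes
   invertible and the product x * y = alpha^-1 (xy) is right alternative, with
   b * b = 0 only for b = 0; A is left Hom-alternative iff x * x * y = x * (x * y).

   In a right alternative algebra right multiplications satisfy the Jordan
   identities, so a symmetrized word in the right multiplications R_p is R_s for
   the corresponding Jordan element s. Let u = xy and a = (x,x,y), and take the
   operators D = R_x R_y - R_u, E = R_a - R_x D (composed from left to right) and
   their reversals D', E'. The operators D D', E E' and E D' + D E' are of the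
   form R_s with s = 0, hence vanish. Then D' R_x D, D' R_x^2 D and E' E are of the
   form R_h with R_h^2 = 0, so h = 0 in the absence of nilpotents. This gives
   R_a^2 = D' R_x E + E' R_x D, whose square is zero; so a is nilpotent. *)
Require Import Defs.
From HB Require Import structures.
From mathcomp Require Import all_boot all_order all_algebra.

Local Open Scope ring_scope.

(** * Jordan and Moufang identities in reduced right alternative rings without 2-torsion *)

Section RightAlternative.
Import GRing.Theory.
Variables (B : zmodType) (mul : B -> B -> B).
Local Infix "**" := mul (at level 40, left associativity).
Hypothesis mulD : forall x y z, (x + y) ** z = x ** z + y ** z.
Hypothesis mulrD : forall x y z, x ** (y + z) = x ** y + x ** z.
Hypothesis ralt : forall x y, x ** (y ** y) = x ** y ** y.
Hypothesis two_torsion_free : forall x : B, x + x = 0 -> x = 0.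
Hypothesis reduced : forall x, x ** x = 0 -> x = 0.

Let mul0 z : 0 ** z = 0.
Proof. by apply: (addrI (0 ** z)); rewrite -mulD !addr0. Qed.
Let mulr0 z : z ** 0 = 0.
Proof. by apply: (addrI (z ** 0)); rewrite -mulrD !addr0. Qed.
Let mulN x z : (- x) ** z = - (x ** z).
Proof. by apply/eqP; rewrite -addr_eq0 -mulD addNr mul0. Qed.
Let mulrN x z : z ** (- x) = - (z ** x).
Proof. by apply/eqP; rewrite -addr_eq0 -mulrD addNr mulr0. Qed.

Lemma ralt_linearized z p q :
  z ** (p ** q) + z ** (q ** p) = z ** p ** q + z ** q ** p.
Proof.
have := ralt z (p + q); rewrite !(mulD, mulrD) !ralt.
rewrite -!addrA => /addrI; rewrite !addrA => /addIr.
by rewrite (addrC (z ** q ** p)).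
Qed.

(** Expanding the linearized identity for the pair [p], [p ** q + q ** p] and subtracting the one
    for [p ** p], [q] leaves twice this equation; the factor 2 is then cancelled. *)
Lemma right_moufang z p q : z ** (p ** q ** p) = z ** p ** q ** p.
Proof.
have E1 := ralt_linearized z p (p ** q + q ** p).
have E2 := ralt_linearized z (p ** p) q.
rewrite mulrD (ralt_linearized p p q) !(mulD, mulrD) in E1.
rewrite !ralt in E2.
have E3 : z ** p ** (p ** q) + z ** p ** (q ** p)
   = z ** p ** p ** q + z ** p ** q ** p by exact: ralt_linearized.
have E4 : z ** (p ** q) ** p + z ** (q ** p) ** p
   = z ** p ** q ** p + z ** q ** p ** p by rewrite -mulD ralt_linearized mulD.
move: E1; rewrite E3 E4 [X in X = _](AC (2*2) (1*4*(2*3)))/=.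
rewrite E2 [X in _ = X](AC (2*2) (1*4*(2*3)))/= => /addrI/eqP.
rewrite -subr_eq0 opprD addrACA => /eqP /two_torsion_free /eqP.
by rewrite subr_eq0 => /eqP.
Qed.

Lemma right_moufang_linearized z p q r :
  z ** (p ** q ** r) + z ** (r ** q ** p) = z ** p ** q ** r + z ** r ** q ** p.
Proof.
have := right_moufang z (p + r) q; rewrite !(mulD, mulrD) !right_moufang.
rewrite -!addrA => /addrI; rewrite !addrA => /addIr.
by rewrite (addrC (z ** p ** q ** r)) addrC.
Qed.

(** Right alternativity turns [(h ** h) ** (h ** h)] into [h ** h ** h ** h], which the assumption
    kills at [z = h ** h]; reducedness applies twice. *)
Lemma square_zero_op_eq0 h : (forall z, z ** h ** h = 0) -> h = 0.
Proof. by move=> H; apply/reduced/reduced; rewrite ralt H. Qed.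

(** * Vanishing of the left associator [(x, x, y)] *)

Section LeftAssociator.
Variables x y u a : B.
Hypotheses (uE : x ** y = u) (aE : x ** x ** y - x ** u = a).
(* Read as words of right multiplications, [D] is [xy - u] and [E] is [a - xD];
   [D'] and [E'] are the reversed words. *)
Let D z := z ** x ** y - z ** u.
Let D' z := z ** y ** x - z ** u.
Let E z := z ** a - D (z ** x).
Let E' z := z ** a - D' z ** x.

Let subrBB (p q r s : B) : p - q - (r - s) = p - (r + q) + s.
Proof. by rewrite opprB opprD !addrA [LHS](ACl (1*4*2*3)). Qed.

Let D_add z w : D (z + w) = D z + D w.
Proof. by rewrite /D !mulD opprD addrACA. Qed.
Let D'_add z w : D' (z + w) = D' z + D' w.
Proof. by rewrite /D' !mulD opprD addrACA. Qed.
Let D_0 : D 0 = 0. Proof. by rewrite /D !mul0 subr0. Qed.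
Let D'_0 : D' 0 = 0. Proof. by rewrite /D' !mul0 subr0. Qed.
Let D_opp z : D (- z) = - D z.
Proof. by apply/eqP; rewrite -addr_eq0 -D_add addNr D_0. Qed.
Let D'_opp z : D' (- z) = - D' z.
Proof. by apply/eqP; rewrite -addr_eq0 -D'_add addNr D'_0. Qed.

Lemma D'_D_eq0 z : D' (D z) = 0.
Proof.
(* The Jordan element whose right multiplication is the palindromic word [D D']; it vanishes because
   [x ** y = u]. *)
have s0 : x ** (y ** y) ** x - (u ** y ** x + x ** y ** u) + u ** u = 0.
  by rewrite ralt uE opprD addrA subrr sub0r addNr.
rewrite /D' /D !(mulD, mulN) subrBB.
rewrite -(mulr0 z) -s0 !(mulrD, mulrN) right_moufang !ralt.
by rewrite right_moufang_linearized (addrC (z ** u ** y ** x)).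
Qed.

(** Since [a] is [D x], this is [D'_D_eq0] at [x]. *)
Let mul_ayx : a ** y ** x = a ** u.
Proof. by apply/eqP; rewrite -subr_eq0 -(D'_D_eq0 x) /D aE. Qed.

Lemma D'_mul_a z : D' (z ** a) = - (D z ** a).
Proof.
have s0 : (a ** y ** x + x ** y ** a) - (a ** u + u ** a) = 0.
  by rewrite mul_ayx uE subrr.
apply/eqP; rewrite -addr_eq0 /D' {1}/D !(mulD, mulN).
rewrite addrACA -opprD -right_moufang_linearized -ralt_linearized.
by rewrite -!mulrD -mulrN -mulrD s0 mulr0.
Qed.

Lemma E'_D z : E' (D z) = - D' (E z).
Proof.
rewrite /E' D'_D_eq0 mul0 subr0 /E.
by rewrite D'_add D'_opp D'_D_eq0 subr0 D'_mul_a opprK.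
Qed.

Lemma E'_E_eq0 z : E' (E z) = 0.
Proof.
have s0 : a ** a - ((x ** x ** y ** a + a ** y ** (x ** x))
    - (x ** u ** a + a ** u ** x)) = 0.
  (* The words starting with [a] cancel by [mul_ayx], and the other two combine to [a ** a]. *)
  rewrite ralt mul_ayx [X in _ - X](_ : _ = a ** a) ?subrr // opprD addrACA.
  by rewrite subrr addr0 -mulN -mulD aE.
have D'_E : D' (E z) = D' (z ** a) by rewrite /E D'_add D'_opp D'_D_eq0 subr0.
rewrite /E' D'_E /E mulD mulN -addrA -opprD.
rewrite -(mulr0 z) -s0 mulrD mulrN; congr (_ - _); first by rewrite ralt.
rewrite !(mulrD, mulrN) !right_moufang_linearized !ralt /D /D' !mulD !mulN.
by rewrite opprD addrACA.
Qed.

Let D_mul_D' z p : D (D' z ** p) = z ** y ** x ** p ** x ** y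
  - (z ** y ** x ** p ** u + z ** u ** p ** x ** y) + z ** u ** p ** u.
Proof. by rewrite /D /D' !(mulD, mulN) subrBB. Qed.

Lemma D_x_D'_eq0 z : D (D' z ** x) = 0.
Proof.
(* [h] is read off the symmetrized word [D' R_x D]. The square of that word has [D'] right after
   [D], hence is zero. *)
pose h := y ** (x ** x ** x) ** y - (y ** (x ** x) ** u + u ** (x ** x) ** y)
  + u ** x ** u.
have hE w : w ** h = D (D' w ** x).
  rewrite D_mul_D' /h !(mulrD, mulrN) right_moufang_linearized !right_moufang.
  by rewrite !ralt.
have -> : D (D' z ** x) = z ** h by rewrite hE.
by rewrite (@square_zero_op_eq0 h) // => w; rewrite !hE D'_D_eq0 mul0 D_0.
Qed.

Lemma D_x_x_D'_eq0 z : D (D' z ** x ** x) = 0.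
Proof.
pose h := y ** (x ** (x ** x) ** x) ** y
  - (y ** (x ** x ** x) ** u + u ** (x ** x ** x) ** y) + u ** (x ** x) ** u.
have hE w : w ** h = D (D' w ** x ** x).
  rewrite -ralt D_mul_D' /h !(mulrD, mulrN) right_moufang_linearized !right_moufang.
  by rewrite !ralt.
have -> : D (D' z ** x ** x) = z ** h by rewrite hE.
by rewrite (@square_zero_op_eq0 h) // => w; rewrite !hE D'_D_eq0 !mul0 D_0.
Qed.

Let E'_mul z p : E' z ** p = z ** a ** p - D' z ** x ** p.
Proof. by rewrite /E' mulD mulN. Qed.

Lemma E_E' z : E (E' z) = z ** a ** a - (D' z ** x ** a + D (z ** a ** x)).
Proof. by rewrite /E !E'_mul D_add D_opp D_x_x_D'_eq0 subr0 -addrA -opprD. Qed.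

(** Right multiplication by [h] is [E] after [E']; in its square [E'] follows [E], and [E'_E_eq0]
    applies. *)
Lemma E_E'_eq0 z : E (E' z) = 0.
Proof.
pose h := a ** a - ((y ** (x ** x) ** a + a ** (x ** x) ** y)
    - (u ** x ** a + a ** x ** u)).
have hE w : w ** h = E (E' w).
  rewrite E_E' /h !(mulrD, mulrN) -!mulrD ralt.
  rewrite !mulrD !right_moufang_linearized !ralt /D /D' !mulD !mulN.
  by rewrite [in RHS]addrACA -opprD.
rewrite -hE (@square_zero_op_eq0 h) // => w; rewrite !hE E'_E_eq0.
by rewrite /E !mul0 D_0 subrr.
Qed.

Lemma mul_aa z : z ** a ** a = D' z ** x ** a + D (z ** a ** x).
Proof. by apply/eqP; rewrite -subr_eq0 -E_E' E_E'_eq0. Qed.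

Lemma left_alternative : x ** x ** y = x ** (x ** y).
Proof.
rewrite uE.
(* These are the two terms of [mul_aa]: replacing a factor [a] there by [E] or [E'] changes each
   only by [D (D' z ** x ** x)], which is zero. *)
pose P z := E (D' z ** x); pose Q z := D (E' z ** x).
have PQ z : z ** a ** a = P z + Q z.
  rewrite mul_aa /P /Q /E D_x_x_D'_eq0 subr0 E'_mul.
  by rewrite D_add D_opp D_x_x_D'_eq0 subr0.
have D'_P z : D' (P z) = 0.
  by rewrite /P -[D' _]opprK -E'_D D_x_D'_eq0 /E' mul0 D'_0 mul0 subr0 oppr0.
have D'_aa z : D' (z ** a ** a) = 0 by rewrite PQ D'_add D'_P /Q D'_D_eq0 addr0.
have aaa z : z ** a ** a ** a = - D' (E (E' z ** x)).
  have -> : z ** a ** a ** a = E' (z ** a ** a).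
    by rewrite /E' D'_aa mul0 subr0.
  have E'_add v w : E' (v + w) = E' v + E' w.
    by rewrite /E' !(mulD, D'_add) opprD addrACA.
  by rewrite PQ E'_add /P /Q E'_E_eq0 add0r E'_D.
apply/eqP; rewrite -subr_eq0; apply/eqP; rewrite aE.
apply: reduced; apply: square_zero_op_eq0 => z.
(* [mul_aa] is used at [z ** a ** a]: its first term dies by [D'_aa], and by [aaa] the second has
   the form [D (D' w ** x)] up to sign. *)
by rewrite !ralt mul_aa D'_aa !mul0 add0r aaa mulN D_opp D_x_D'_eq0 oppr0.
Qed.
End LeftAssociator.
End RightAlternative.

(** * Direct limit along an injective additive endomorphism *)

Section DirectLimit.
Import GRing.Theory.
Local Open Scope quotient_scope.
Variables (V : zmodType) (f : {additive V -> V}).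
Hypothesis f_inj : injective f.

Lemma iter_inj n : injective (iter n f).
Proof. by elim: n => //= n IHn x y /f_inj /IHn. Qed.

Lemma iter_additive n x y : iter n f (x + y) = iter n f x + iter n f y.
Proof. by elim: n => //= n ->; rewrite raddfD. Qed.

Lemma iter_opp n x : iter n f (- x) = - iter n f x.
Proof. by elim: n => //= n ->; rewrite raddfN. Qed.

Lemma iter0f n : iter n f 0 = 0.
Proof. by elim: n => //= n ->; rewrite raddf0. Qed.

Lemma iterAC m n x : iter m f (iter n f x) = iter n f (iter m f x).
Proof. by rewrite -!iterD addnC. Qed.

(** Cross-multiplied equality of the fractions [f^-n x]. Injectivity of [f] makes this transitive
    without passing to a later stage of the limit. *)
Definition lim_equiv (p q : nat * V) := iter q.1 f p.2 == iter p.1 f q.2.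

Lemma lim_equiv_refl : reflexive lim_equiv.
Proof. by move=> p; exact: eqxx. Qed.
Lemma lim_equiv_sym : symmetric lim_equiv.
Proof. by move=> p q; exact: eq_sym. Qed.
Lemma lim_equiv_trans : transitive lim_equiv.
Proof.
move=> [n y] [m x] [l z] /= /eqP /= xy /eqP /= yz; apply/eqP => /=.
apply: (@iter_inj n); rewrite -!iterD addnC iterD xy -iterD addnC iterD yz.
by rewrite -!iterD addnC.
Qed.
Canonical lim_equiv_equiv :=
  EquivRel lim_equiv lim_equiv_refl lim_equiv_sym lim_equiv_trans.

Definition lim := {eq_quot lim_equiv}.
HB.instance Definition _ : EqQuotient _ lim_equiv lim := EqQuotient.on lim.
HB.instance Definition _ := Choice.on lim.

(* [germ n x] stands for f^-n x. *)
Definition germ n x : lim := \pi_lim (n, x).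

Lemma germ_eq n x m y : germ n x = germ m y <-> iter m f x = iter n f y.
Proof. by split=> [/eqmodP/eqP|/eqP e] //; apply/eqmodP. Qed.

Lemma germS k n x : germ (k + n) (iter k f x) = germ n x.
Proof. by apply/germ_eq; rewrite -iterD addnC. Qed.

Lemma germ_succ n x : germ n.+1 (f x) = germ n x.
Proof. exact: (germS 1). Qed.

Lemma germP (b : lim) : exists n x, b = germ n x.
Proof. by elim/quotW: b => [[n x]]; exists n, x. Qed.

Lemma germP2 (b c : lim) : exists n x y, b = germ n x /\ c = germ n y.
Proof.
have [n [x ->]] := germP b; have [m [y ->]] := germP c.
by exists (m + n)%N, (iter m f x), (iter n f y); rewrite germS addnC germS.
Qed.

Lemma germP3 (b c d : lim) :
  exists n x y z, [/\ b = germ n x, c = germ n y & d = germ n z].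
Proof.
have [n [x [y [-> ->]]]] := germP2 b c; have [m [z ->]] := germP d.
exists (m + n)%N, (iter m f x), (iter m f y), (iter n f z).
by rewrite !germS addnC germS.
Qed.

Definition lim_add (b c : lim) : lim :=
  germ ((repr b).1 + (repr c).1)
    (iter (repr c).1 f (repr b).2 + iter (repr b).1 f (repr c).2).
Definition lim_opp (b : lim) : lim := germ (repr b).1 (- (repr b).2).

(** The representative is an arbitrary choice; this relation is what makes the operations on the
    limit independent of it. *)
Lemma repr_germ n x : iter n f (repr (germ n x)).2 = iter (repr (germ n x)).1 f x.
Proof. by apply/germ_eq; rewrite /germ -surjective_pairing reprK. Qed.

Lemma lim_addE n x y : lim_add (germ n x) (germ n y) = germ n (x + y).
Proof.
apply/germ_eq; rewrite !iter_additive !(iterAC n) !repr_germ -!iterD.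
by rewrite [((repr (germ n y)).1 + _)%N]addnC.
Qed.

Lemma lim_oppE n x : lim_opp (germ n x) = germ n (- x).
Proof. by apply/germ_eq; rewrite !iter_opp repr_germ. Qed.

Lemma lim_addA : associative lim_add.
Proof.
move=> b c d; have [n [x [y [z [-> -> ->]]]]] := germP3 b c d.
by rewrite !lim_addE addrA.
Qed.

Lemma lim_addC : commutative lim_add.
Proof.
by move=> b c; have [n [x [y [-> ->]]]] := germP2 b c; rewrite !lim_addE addrC.
Qed.

Lemma germ0 n : germ n 0 = germ 0 0.
Proof. by apply/germ_eq; rewrite !iter0f. Qed.

Lemma lim_add0 : left_id (germ 0 0) lim_add.
Proof.
by move=> b; have [n [x ->]] := germP b; rewrite -(germ0 n) lim_addE add0r.
Qed.

Lemma lim_addN : left_inverse (germ 0 0) lim_opp lim_add.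
Proof.
move=> b; have [n [x ->]] := germP b.
by rewrite lim_oppE lim_addE addNr germ0.
Qed.

HB.instance Definition _ :=
  GRing.isZmodule.Build lim lim_addA lim_addC lim_add0 lim_addN.

Lemma germD n x y : germ n x + germ n y = germ n (x + y).
Proof. exact: lim_addE. Qed.

Lemma germ_eq0 n x : germ n x = 0 <-> x = 0.
Proof.
by split=> [|->]; [rewrite -[RHS](germ0 n) => /germ_eq/iter_inj | exact: germ0].
Qed.

Lemma germ_inj n : injective (germ n).
Proof. by move=> x y /germ_eq /iter_inj. Qed.

(** * The untwisted product on the limit *)

Variable mul : V -> V -> V.
Hypothesis mulDl : forall x y z, mul (x + y) z = mul x z + mul y z.
Hypothesis mulDr : forall x y z, mul x (y + z) = mul x y + mul x z.
Hypothesis f_mul : forall x y, f (mul x y) = mul (f x) (f y).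

Lemma iter_mul n x y : iter n f (mul x y) = mul (iter n f x) (iter n f y).
Proof. by elim: n => //= n ->. Qed.

(* The twisted product f^-1 (mul b c), extended to the limit. *)
Definition lim_mul (b c : lim) : lim :=
  germ ((repr b).1 + (repr c).1).+1
    (mul (iter (repr c).1 f (repr b).2) (iter (repr b).1 f (repr c).2)).

Lemma lim_mulE n x y :
  lim_mul (germ n x) (germ n y) = germ n.+1 (mul x y).
Proof.
apply/germ_eq; rewrite !iterS !iter_mul !(iterAC n) !repr_germ.
by rewrite -!iterD [((repr (germ n y)).1 + _)%N]addnC.
Qed.

Lemma lim_mulDl b c d : lim_mul (b + c) d = lim_mul b d + lim_mul c d.
Proof.
have [n [x [y [z [-> -> ->]]]]] := germP3 b c d.
by rewrite germD !lim_mulE mulDl germD.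
Qed.

Lemma lim_mulDr b c d : lim_mul b (c + d) = lim_mul b c + lim_mul b d.
Proof.
have [n [x [y [z [-> -> ->]]]]] := germP3 b c d.
by rewrite germD !lim_mulE mulDr germD.
Qed.

Lemma lim_right_alternative :
  (forall x y, mul (f x) (mul y y) = mul (mul x y) (f y)) ->
  forall b c, lim_mul b (lim_mul c c) = lim_mul (lim_mul b c) c.
Proof.
move=> ralt b c; have [n [x [y [-> ->]]]] := germP2 b c.
(* An inner product has index [n.+1], so the remaining factor is raised to that index; this brings
   in the [f] of the Hom-identity. *)
rewrite !lim_mulE -(germ_succ n x) -[in RHS](germ_succ n y) !lim_mulE.
by rewrite ralt.
Qed.

Lemma lim_reduced :
  (forall x : V, mul x x = 0 -> x = 0) -> forall b, lim_mul b b = 0 -> b = 0.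
Proof.
move=> red b; have [n [x ->]] := germP b.
by rewrite lim_mulE => /germ_eq0 /red ->; apply/germ_eq0.
Qed.

Lemma lim_two_torsion_free :
  (forall x : V, x + x = 0 -> x = 0) -> forall b : lim, b + b = 0 -> b = 0.
Proof.
move=> tf b; have [n [x ->]] := germP b.
by rewrite germD => /germ_eq0 /tf ->; apply/germ_eq0.
Qed.

Lemma hom_left_alternative :
  (forall x y, mul (f x) (mul y y) = mul (mul x y) (f y)) ->
  (forall x : V, x + x = 0 -> x = 0) ->
  (forall x : V, mul x x = 0 -> x = 0) ->
  forall x y, mul (mul x x) (f y) = mul (f x) (mul x y).
Proof.
(* Two nested products of elements of index 0 have index 2. *)
move=> ralt tf red x y; apply: (@germ_inj 2).
rewrite -!lim_mulE !germ_succ.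
apply: (@left_alternative _ lim_mul _ _ _ _ _ _ _ _ _ erefl erefl).
- exact: lim_mulDl.
- exact: lim_mulDr.
- exact: lim_right_alternative.
- exact: lim_two_torsion_free.
- exact: lim_reduced.
Qed.
End DirectLimit.

(** * Application to Hom-algebras *)

Theorem corollary1p4 (k : fieldType) (hk : [pchar k] =i pred0)
    (A : lmodType k) (mu : {bilinear A -> A -> A}) (alpha : {linear A -> A})
    (hmul : multiplicative mu alpha)
    (hright : right_hom_alternative mu alpha)
    (hinj : injective alpha)
    (hnil : ~ exists x : A, hom_nilpotent mu alpha x) :
  hom_alternative mu alpha.
Proof.
split=> // x y; rewrite /hom_associator.
suff -> : mu (mu x x) (alpha y) = mu (alpha x) (mu x y) by rewrite GRing.subrr.
apply: (@hom_left_alternative A alpha hinj (fun x y => mu x y)) => {x y}.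
- by move=> x y z; rewrite linearDl.
- by move=> x y z; rewrite linearDr.
- exact: hmul.
- by move=> x y; apply/esym/eqP; rewrite -GRing.subr_eq0; apply/eqP/hright.
(* [x + x] is [2 *: x], and 2 is nonzero in characteristic 0. *)
- move=> x /eqP; rewrite -GRing.mulr2n -GRing.scaler_nat GRing.scaler_eq0.
  by move: (hk 2%N); rewrite !inE /= => -> /eqP.
- move=> x xx0; have [//|x_neq0] := eqVneq x 0.
  (* The second Hom-power carries the twist [alpha^0], so it is the plain square [mu x x]. *)
  by case: hnil; exists x; split=> //; exists 2%N.
Qed.
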